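(* Let $n>1$. In $K_n$ we have $|B(f,1)|=1+|K_{n-1}|$ and consequently $|S(f,1)|=|K_{n-1}|$.
   Context: For a natural number $k$, $[k]=\{1,\dots,k\}$, and $[0]=\emptyset$. For $n\ge1$, Kiselman's semigroup $K_n$ is the (finite) monoid, with unit element $e$, given by generators $a_1,\dots,a_n$ and relations $a_i^2=a_i$ for all $i\in[n]$, and $a_i a_j a_i = a_j a_i a_j = a_i a_j$ for all $1\le j<i\le n$. The element $f=a_na_{n-1}\cdots a_1$ is the zero element of $K_n$. For $X\subseteq[n]$, the deletion endomorphism $\overline{\partial}_X:K_n\to K_n$ is the unique monoid endomorphism with $\overline{\partial}_X(a_i)=a_i$ if $i\notin X$ and $\overline{\partial}_X(a_i)=e$ if $i\in X$. The ultrametric $d$ on $K_n$ is $d(x,y)=\min\{i\in\{0,1,\dots,n\}\mid \overline{\partial}_{[i]}(x)=\overline{\partial}_{[i]}(y)\}$; $B(a,r)=\{x\in K_n\mid d(a,x)\le r\}$ and $S(a,r)=\{x\in K_n\mid d(a,x)=r\}$. *)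

(* Defs.v *)
From HB Require Import structures.
From mathcomp Require Import all_boot.
From mathcomp Require Import boolp.

Set Implicit Arguments.
Unset Strict Implicit.
Unset Printing Implicit Defensive.

Local Open Scope group_scope.
Local Open Scope quotient_scope.

(* Indices are 0-based: the ordinal i : 'I_n stands for the index i + 1 of    *)
(* [n] = {1, ..., n}. An element of the free monoid on a_1, ..., a_n is a     *)
(* word in seq 'I_n.                                                          *)

Inductive kiselman_rel (n : nat) : seq 'I_n -> seq 'I_n -> Prop :=
| krel_idem (i : 'I_n) :
    kiselman_rel [:: i; i] [:: i]
| krel_iji (i j : 'I_n) : (j < i)%N ->
    kiselman_rel [:: i; j; i] [:: i; j]
| krel_jij (i j : 'I_n) : (j < i)%N ->
    kiselman_rel [:: j; i; j] [:: i; j]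
| krel_refl u : kiselman_rel u u
| krel_sym u v : kiselman_rel u v -> kiselman_rel v u
| krel_trans u v w : kiselman_rel u v -> kiselman_rel v w -> kiselman_rel u w
| krel_cat u u' v v' : kiselman_rel u u' -> kiselman_rel v v' ->
    kiselman_rel (u ++ v) (u' ++ v').

Definition kiselman_relb (n : nat) : rel (seq 'I_n) :=
  fun u v => `[< kiselman_rel u v >].

Lemma kiselman_relb_equiv n : equiv_class_of (@kiselman_relb n).
Proof.
split=> [u|u v|v u w].
- exact/asboolP/krel_refl.
- by apply/asboolP/asboolP; apply: krel_sym.
- by move=> /asboolP uv /asboolP vw; apply/asboolP/(krel_trans uv vw).
Qed.

Canonical kiselman_equiv (n : nat) : equiv_rel (seq 'I_n) :=
  EquivRelPack (kiselman_relb_equiv n).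

Definition kiselman (n : nat) : Type := {eq_quot (kiselman_equiv n)}.
HB.instance Definition _ n := Choice.on (kiselman n).
HB.instance Definition _ n := EqQuotient.on (kiselman n).

Definition kword (n : nat) (u : seq 'I_n) : kiselman n := \pi u.

Lemma kwordP n (u v : seq 'I_n) : kword u = kword v <-> kiselman_rel u v.
Proof.
split=> [/eqmodP/asboolP//|uv].
by apply/eqmodP/asboolP.
Qed.

Lemma kword_ind n (P : kiselman n -> Prop) :
  (forall u, P (kword u)) -> forall x, P x.
Proof. by move=> Pw x; rewrite -[x]reprK; apply: Pw. Qed.

Definition kmul (n : nat) (x y : kiselman n) : kiselman n :=
  kword (repr x ++ repr y).

Lemma kword_repr n (x : kiselman n) : kword (repr x) = x.
Proof. exact: reprK. Qed.

Lemma kmulE n (u v : seq 'I_n) : kmul (kword u) (kword v) = kword (u ++ v).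
Proof. by apply/kwordP/krel_cat; apply/kwordP; rewrite kword_repr. Qed.

Lemma kmulA n : associative (@kmul n).
Proof.
elim/kword_ind=> u; elim/kword_ind=> v; elim/kword_ind=> w.
by rewrite !kmulE catA.
Qed.

Lemma kmul1x n : left_id (kword [::]) (@kmul n).
Proof. by elim/kword_ind=> u; rewrite kmulE. Qed.

Lemma kmulx1 n : right_id (kword [::]) (@kmul n).
Proof. by elim/kword_ind=> u; rewrite kmulE cats0. Qed.

HB.instance Definition _ n :=
  isMonoid.Build (kiselman n) (@kmulA n) (@kmul1x n) (@kmulx1 n).

Definition kgen (n : nat) (i : 'I_n) : kiselman n := kword [:: i].

Lemma kwordM n (u v : seq 'I_n) : kword (u ++ v) = kword u * kword v.
Proof. by rewrite -kmulE. Qed.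

Lemma kword_prod n (u : seq 'I_n) : kword u = \prod_(i <- u) kgen i.
Proof.
elim: u => [|i u IHu]; first by rewrite big_nil.
by rewrite big_cons -IHu -kwordM.
Qed.

Lemma kgen_idem n (i : 'I_n) : kgen i * kgen i = kgen i.
Proof. by rewrite -kwordM; apply/kwordP/krel_idem. Qed.

Lemma kgen_iji n (i j : 'I_n) : (j < i)%N ->
  kgen i * kgen j * kgen i = kgen i * kgen j.
Proof.
move=> ji; rewrite -[kgen i * kgen j]kwordM -kwordM.
exact/kwordP/krel_iji.
Qed.

Lemma kgen_jij n (i j : 'I_n) : (j < i)%N ->
  kgen j * kgen i * kgen j = kgen i * kgen j.
Proof.
move=> ji; rewrite -[kgen j * kgen i]kwordM -[kgen i * kgen j]kwordM -kwordM.
exact/kwordP/krel_jij.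
Qed.

(* Finiteness. After a letter k, later occurrences of k can be erased as long *)
(* as no letter above k occurs, so every word over the first k letters is     *)
(* equivalent to one of length less than 2 ^ k.                               *)

Lemma kword_absorb n (k : 'I_n) (v : seq 'I_n) :
  all (fun j : 'I_n => (j <= k)%N) v -> kword (k :: rcons v k) = kword (k :: v).
Proof.
elim/last_ind: v => [_|v j IHv]; first exact/kwordP/krel_idem.
rewrite all_rcons => /andP[jk /IHv {}IHv].
move: jk; rewrite leq_eqVlt => /orP[/eqP/val_inj->|jk].
  rewrite -!rcons_cons -!cats1 !kwordM -mulgA; congr (_ * _).
  exact: kgen_idem.
rewrite -!rcons_cons -!cats1 !kwordM -!/(kgen _) in IHv *.
rewrite -IHv -!mulgA; congr (_ * _).
by rewrite mulgA kgen_iji.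
Qed.

Lemma kword_erase n (k : 'I_n) (v : seq 'I_n) :
    all (fun j : 'I_n => (j <= k)%N) v ->
  kword (k :: v) = kword (k :: [seq j : 'I_n <- v | (j < k)%N]).
Proof.
elim/last_ind: v => // v j IHv vk; move: (vk).
rewrite all_rcons => /andP[jk /[dup] {}vk /IHv {}IHv].
rewrite filter_rcons; case: ltnP => kj.
  by rewrite -!rcons_cons -!cats1 !kwordM IHv.
have -> : j = k by apply/val_inj/eqP; rewrite eqn_leq jk.
by rewrite kword_absorb.
Qed.

Lemma kword_short n k (w : seq 'I_n) : all (fun j : 'I_n => (j < k)%N) w ->
  exists2 v : seq 'I_n, (size v < 2 ^ k)%N & kword w = kword v.
Proof.
elim: k w => [[|//] _|k IHk w wk]; first by exists [::].
have low (s : seq 'I_n) : all (fun j : 'I_n => (j < k.+1)%N) s ->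
    ~~ has (fun j : 'I_n => j == k :> nat) s ->
    all (fun j : 'I_n => (j < k)%N) s.
  move=> /allP sk /hasPn kNs; apply/allP=> j js.
  by have := sk j js; rewrite ltnS leq_eqVlt (negPf (kNs j js)).
have [kw|/(low _ wk)/IHk[v vk ->]] :=
  boolP (has (fun j : 'I_n => j == k :> nat) w); last first.
  by exists v => //; rewrite (leq_trans vk) // leq_exp2l.
case/split_find: kw wk => i u v /eqP ik kNu; rewrite all_cat all_rcons.
move=> /andP[/andP[_ /low/(_ kNu)/IHk[u' uk uu']] vk].
have [|v' vk' vv'] := IHk [seq j : 'I_n <- v | (j < i)%N].
  by rewrite -ik filter_all.
exists (u' ++ i :: v').
  by rewrite size_cat /= expnS mul2n -addnn -addSn leq_add.
rewrite cat_rcons !kwordM kword_erase ?ik //.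
by rewrite -cat1s -[i :: v']cat1s !kwordM uu' -ik vv'.
Qed.

Lemma kword_bseq_surj n (x : kiselman n) :
  exists v : (2 ^ n).-bseq 'I_n, x = kword v.
Proof.
elim/kword_ind: x => u.
have [|v vn ->] := @kword_short n n u; first by apply/allP=> j _; apply: ltn_ord.
by exists (Bseq (ltnW vn)).
Qed.

Definition kiselman_enum (n : nat) : seq (kiselman n) :=
  undup [seq kword v | v : (2 ^ n).-bseq 'I_n].

Lemma kiselman_enumP n : Finite.axiom (kiselman_enum n).
Proof.
move=> x; rewrite count_uniq_mem ?undup_uniq // mem_undup.
by have [v ->] := kword_bseq_surj x; rewrite image_f.
Qed.

HB.instance Definition _ n := Countable.on (kiselman n).
HB.instance Definition _ n := isFinite.Build (kiselman n) (@kiselman_enumP n).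

Definition kdel (n : nat) (X : {set 'I_n}) (x : kiselman n) : kiselman n :=
  kword [seq i <- repr x | i \notin X].

Lemma kdel_word n (X : {set 'I_n}) (u : seq 'I_n) :
  kdel X (kword u) = kword [seq i <- u | i \notin X].
Proof.
apply/kwordP; have: kiselman_rel (repr (kword u)) u.
  by apply/kwordP; rewrite kword_repr.
move: (repr _) => v.
elim=> {u v} /= [i|i j ji|i j ji|v|v w _|v w t _ vw _|v v' w w' _ vv' _ ww'].
- by case: (i \notin X); [apply: krel_idem|apply: krel_refl].
- case: (i \notin X); case: (j \notin X).
  + exact: krel_iji.
  + exact: krel_idem.
  + exact: krel_refl.
  + exact: krel_refl.
- case: (i \notin X); case: (j \notin X).
  + exact: krel_jij.
  + exact: krel_refl.
  + exact: krel_idem.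
  + exact: krel_refl.
- exact: krel_refl.
- exact: krel_sym.
- exact: krel_trans.
- by rewrite !filter_cat; apply: krel_cat.
Qed.

Lemma kdel_monoid_morphism n (X : {set 'I_n}) : monoid_morphism (kdel X).
Proof.
split; first exact: kdel_word.
elim/kword_ind=> u; elim/kword_ind=> v.
by rewrite -kwordM !kdel_word filter_cat kwordM.
Qed.

HB.instance Definition _ n (X : {set 'I_n}) :=
  isUMagmaMorphism.Build (kiselman n) (kiselman n) (kdel X)
    (kdel_monoid_morphism X).

Lemma kdel_gen n (X : {set 'I_n}) (i : 'I_n) :
  kdel X (kgen i) = if i \in X then 1 else kgen i.
Proof. by rewrite kdel_word /=; case: ifP => /negP; case: (i \in X). Qed.

Lemma kdel_unique n (X : {set 'I_n}) (g : kiselman n -> kiselman n) :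
    monoid_morphism g ->
    (forall i, g (kgen i) = if i \in X then 1 else kgen i) ->
  g =1 kdel X.
Proof.
move=> [g1 gM] gE; have [d1 dM] := kdel_monoid_morphism X.
elim/kword_ind=> u; rewrite kword_prod (big_morph g gM g1) (big_morph _ dM d1).
by apply: eq_bigr => i _; rewrite gE kdel_gen.
Qed.

(* The set [k] = {1, ..., k}, as a set of 0-based indices.                    *)
Definition kseg (n k : nat) : {set 'I_n} := [set i : 'I_n | (i < k)%N].

Lemma kdist_subproof n (x y : kiselman n) :
  exists i, (i <= n)%N && (kdel (kseg n i) x == kdel (kseg n i) y).
Proof.
exists n; rewrite leqnn; elim/kword_ind: x => u; elim/kword_ind: y => v /=.
have nil (w : seq 'I_n) : [seq i <- w | i \notin kseg n n] = [::].
  by apply/eqP; rewrite -[_ == _]negbK -has_filter;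
     apply/hasPn=> i _; rewrite inE ltn_ord.
by rewrite !kdel_word !nil.
Qed.

Definition kdist (n : nat) (x y : kiselman n) : nat :=
  ex_minn (kdist_subproof x y).

Definition kball (n : nat) (a : kiselman n) (r : nat) : {set kiselman n} :=
  [set x | (kdist a x <= r)%N].

Definition ksphere (n : nat) (a : kiselman n) (r : nat) : {set kiselman n} :=
  [set x | kdist a x == r].

(* f = a_n a_(n-1) ... a_1                                                    *)
Definition kzero (n : nat) : kiselman n := \prod_(i <- rev (enum 'I_n)) kgen i.

(* Main.v *)
(* The ball consists of the classes of words containing a_n, ..., a_2 as a    *)
(* subsequence, a property which the relations preserve. Such an element      *)
(* either avoids a_1, and is then a_n ... a_2, or is of the form u a_1 v with *)
(* u and v free of a_1; in the latter case it equals u a_1 a_n ... a_2, and   *)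
(* the class of u in K_(n-1) can be recovered from it, since the prefix       *)
(* before the last a_1, with all its a_1 erased, is well defined up to the    *)
(* relations. Hence these elements correspond to the elements u of K_(n-1).   *)
Require Import Defs.
From mathcomp Require Import all_boot.

Set Implicit Arguments.
Unset Strict Implicit.
Unset Printing Implicit Defensive.

(** A word represents a point of the ball exactly when deleting a_1 turns it into a_n ... a_2, the
    zero of the submonoid generated by a_2, ..., a_n. This amounts to containing a_n, ..., a_2 as a
    subsequence, which [run] tests and which by [run_rel] depends only on the class
    ([mem_kball_kzero]). By [kword_erase_ord0] and [kword_run_cat_eq0] such a class is a_n ... a_2
    or u a_1 a_n ... a_2 with u free of a_1 ([kball_kzero]). Here u is arbitrary, and
    [kiselman_rel_before_last0] recovers its class. The sphere omits only the centre
    ([card_kball1]). *)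

Lemma mem_split_last (T : eqType) (x : T) (s : seq T) : x \in s ->
  exists p q, s = p ++ x :: q /\ x \notin q.
Proof.
elim: s => //= y s IHs; rewrite inE.
have [/IHs[p [q [-> Nq]]] _|Ns] := boolP (x \in s).
  by exists (y :: p), q.
by rewrite orbF => /eqP xy; exists [::], s; rewrite -xy.
Qed.

(** * Balls in terms of deletion endomorphisms *)

Lemma mem_kball n (a x : kiselman n) r : r <= n ->
  (x \in kball a r) = (kdel (kseg n r) a == kdel (kseg n r) x).
Proof.
move=> rn; rewrite inE /kdist; case: ex_minnP => i /andP[_ /eqP ax] i_min.
apply/idP/idP => [ir|E]; last by apply: i_min; rewrite rn E.
(* Deleting [[r]] can be done after deleting [[i]], so agreement at [i] persists at [r]. *)
have kdelS (y : kiselman n) :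
    kdel (kseg n r) y = kdel (kseg n r) (kdel (kseg n i) y).
  elim/kword_ind: y => w; rewrite !kdel_word -filter_predI.
  congr kword; apply: eq_filter => j; rewrite !inE /= -!leqNgt.
  by case: (leqP r j) => // /(leq_trans ir)->.
by rewrite kdelS ax -kdelS.
Qed.

Lemma kdist_eq0 n (a x : kiselman n) : (kdist a x == 0) = (x == a).
Proof.
rewrite -leqn0; have := @mem_kball n a x 0 isT; rewrite inE => ->.
have kdel0 (y : kiselman n) : kdel (kseg n 0) y = y.
  elim/kword_ind: y => w; rewrite kdel_word; congr kword.
  by rewrite -[RHS]filter_predT; apply: eq_filter => j; rewrite inE.
by rewrite !kdel0 eq_sym.
Qed.

Lemma card_kball1 n (a : kiselman n) : #|kball a 1| = (#|ksphere a 1|).+1.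
Proof.
have -> : kball a 1 = a |: ksphere a 1.
  by apply/setP=> x; rewrite !inE -kdist_eq0; case: kdist => [|[]].
by rewrite cardsU1 inE (eqP (_ : kdist a a == 0)) // kdist_eq0.
Qed.

(* The automaton reading the letters t, t - 1, ..., 1 greedily, in this       *)
(* order; its state is the next letter to be read, 0 meaning completion.      *)
Definition step (t i : nat) : nat := if i == t then t.-1 else t.

Definition run n (t : nat) (w : seq 'I_n) : nat :=
  foldl (fun t (i : 'I_n) => step t i) t w.

Lemma run_cat n t (u v : seq 'I_n) : run t (u ++ v) = run (run t u) v.
Proof. exact: foldl_cat. Qed.

(** The state never increases, and a step that reads [j] ends below every [i > j]. So after [i j] a
    further [i] has no effect, and a [j] put before [i j] does not change the final state. *)
Lemma run_rel n (u v : seq 'I_n) : kiselman_rel u v ->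
  forall t, run t u = run t v.
Proof.
have step_idem i t : step (step t i) i = step t i.
  by rewrite /step; case: (eqVneq i t) => [->|/negPf-> //]; case: t => //= t;
    rewrite gtn_eqF.
have step_lt i j t : j < i ->
    (step (step (step t i) j) i = step (step t i) j) *
    (step (step (step t j) i) j = step (step t i) j).
  move=> ji; have [->|nit] := eqVneq t i.
    have -> : step i j = i by rewrite /step ltn_eqF.
    split=> //.
    have step_le k s : step s k <= s.
      by rewrite /step; case: ifP => // _; apply: leq_pred.
    rewrite [LHS]/step gtn_eqF // (leq_ltn_trans (step_le _ _)) // /step eqxx.
    by rewrite prednK // (leq_trans _ ji).
  have -> : step t i = t by rewrite /step eq_sym (negPf nit).
  suff -> : step (step t j) i = step t j by rewrite step_idem.
  rewrite {1}/step; case: eqP => // E; move: E nit ji; rewrite /step.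
  case: (eqVneq j t) => [-> ->|_ ->]; last by rewrite eqxx.
  by rewrite ltnNge leq_pred.
elim=> {u v} /= [i|i j ji|i j ji|u|u v _ IH|u v w _ IH1 _ IH2|u v w z _ IH1 _ IH2] t.
- by rewrite /run /= step_idem.
- by rewrite /run /= (step_lt _ _ _ ji).1.
- by rewrite /run /= (step_lt _ _ _ ji).2.
- by [].
- by rewrite IH.
- by rewrite IH1.
- by rewrite !run_cat IH1 IH2.
Qed.

Lemma run_notin n t (w : seq 'I_n) :
  all (fun i : 'I_n => i != t :> nat) w -> run t w = t.
Proof.
by elim: w => //= i w IHw /andP[/negPf it /IHw]; rewrite /run /= /step it.
Qed.

Lemma run_lt n t s (w : seq 'I_n) : t < s ->
  run t [seq i : 'I_n <- w | i < s] = run t w.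
Proof.
elim: w t => //= i w IHw t ts; rewrite /run /=; case: ltnP => si /=.
  apply: IHw; rewrite /step; case: eqP => // _.
  by rewrite (leq_ltn_trans (leq_pred _)).
rewrite -/(run _ _) IHw //; congr foldl.
by rewrite /step gtn_eqF // (leq_trans ts).
Qed.

(** The letter 0, that is a_1, can only match state 0, which it keeps because [0.-1 = 0]. *)
Lemma run_gt0 n t (w : seq 'I_n) :
  run t [seq i : 'I_n <- w | 0 < i] = run t w.
Proof.
elim: w t => //= i w IHw t; rewrite /run /=.
case: posnP => [i0|_] /=; last exact: IHw.
rewrite -/(run _ _) IHw; congr foldl.
by rewrite /step i0; case: eqP => // <-.
Qed.

Lemma run_rev_enum n : run n (rev (enum 'I_n.+1)) = 0.
Proof.
have foldl_val t (w : seq 'I_n.+1) : run t w = foldl step t (map val w).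
  by elim: w t => //= i w IHw t; rewrite -IHw.
rewrite foldl_val map_rev val_enum_ord.
suff all_k k : foldl step k (rev (iota 0 k.+1)) = 0 by apply: all_k.
elim: k => // k IHk.
by rewrite -[k.+2]addn1 iotaD cats1 rev_rcons add0n /= {2}/step eqxx IHk.
Qed.

(** * Normal forms of words that pass the subsequence test *)

Section Positive.
Variable m : nat.
Implicit Types (i : 'I_m.+1) (u v w p q : seq 'I_m.+1).

(** The word a_(k+1) ... a_2. As [inord] gives the intended letter only up to [m], lemmas on it
    assume [k <= m]. *)
Fixpoint desc k : seq 'I_m.+1 := if k is k'.+1 then inord k :: desc k' else [::].

Definition within k : pred 'I_m.+1 := fun i => 0 < i <= k.

Lemma all_desc k : k <= m -> all (within k) (desc k).
Proof.
elim: k => //= k IHk km; rewrite {1}/within inordK // ltnSn /=.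
by apply: sub_all (IHk (ltnW km)) => i /andP[i0 ik]; rewrite /within i0 leqW.
Qed.

Lemma kword_cat_congr n (u u' v v' : seq 'I_n) :
  kword u = kword u' -> kword v = kword v' -> kword (u ++ v) = kword (u' ++ v').
Proof. by rewrite !kwordM => -> ->. Qed.

Lemma kword_cons_congr n (i : 'I_n) (v v' : seq 'I_n) :
  kword v = kword v' -> kword (i :: v) = kword (i :: v').
Proof. exact: (@kword_cat_congr _ [:: i] [:: i]). Qed.

Lemma kword_cons_desc k i : k <= m -> within k i ->
  kword (i :: desc k) = kword (desc k).
Proof.
elim: k => [|k IHk] km /andP[i0]; first by rewrite leqNgt i0.
rewrite leq_eqVlt => /orP[/eqP ik|ik] /=.
  have -> : i = inord k.+1 by apply/val_inj; rewrite /= inordK.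
  apply: (@kword_cat_congr _ [:: _; _] [:: _]) => //.
  exact/kwordP/krel_idem.
(* By induction [desc k] absorbs [i] on its left; inserting [i] there on both sides leaves an
   instance of [krel_jij]. *)
rewrite -(kword_cons_congr (inord k.+1) (IHk (ltnW km) _)); last by rewrite /within i0.
apply: etrans (kword_cons_congr _ (kword_cons_congr _ (esym (IHk (ltnW km) _)))) _.
  by rewrite /within i0.
apply: (@kword_cat_congr _ [:: _; _; _] [:: _; _]) => //.
by apply/kwordP/krel_jij; rewrite inordK.
Qed.

Lemma kword_cat_desc k w : k <= m -> all (within k) w ->
  kword (w ++ desc k) = kword (desc k).
Proof.
move=> km; elim: w => //= i w IHw /andP[ik /IHw wk].
by rewrite (kword_cons_congr _ wk) kword_cons_desc.
Qed.

Lemma all_within_filter k w : all (within k.+1) w ->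
  all (within k) [seq i : 'I_m.+1 <- w | i < k.+1].
Proof.
move=> /allP wk; apply/allP=> i; rewrite mem_filter => /andP[ik /wk/andP[i0 _]].
by rewrite /within i0.
Qed.

Lemma filter_desc k : k <= m ->
  [seq i : 'I_m.+1 <- desc k | (i < k.+1)] = desc k.
Proof.
by move=> km; apply/all_filterP; apply: sub_all (all_desc km) => i /andP[_].
Qed.

(** [runP] cuts [w] at the first letter [k.+1], if any. The filter removes its later copies, so that
    inductions on [k] go down one letter. *)
Variant run_spec k w : Prop :=
| RunNotin of run k.+1 w = k.+1 & (forall v, run k.+1 (w ++ v) = run k.+1 v)
| RunIn p q of w = p ++ inord k.+1 :: q &
    (forall v, run k.+1 (w ++ v) = run k [seq i : 'I_m.+1 <- q ++ v | i < k.+1]).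

Lemma runP k w : k < m -> run_spec k w.
Proof.
move=> km; have [|kNw] := boolP (has (pred1 (inord k.+1)) w); last first.
  have E : run k.+1 w = k.+1.
    apply: run_notin; apply/allP=> i /(hasPn kNw) /=; apply: contraNneq => ik.
    by apply/eqP/val_inj; rewrite /= inordK.
  by apply: RunNotin => // v; rewrite run_cat E.
case/split_find=> i p q /eqP -> /hasPn kNp; apply: (@RunIn _ _ p q) => [|v].
  by rewrite cat_rcons.
rewrite run_lt // cat_rcons -catA run_cat (@run_notin _ _ p); last first.
  apply/allP=> j /kNp /=; apply: contraNneq => jk.
  by apply/eqP/val_inj; rewrite /= inordK.
by rewrite /run /= /step inordK // eqxx.
Qed.

(** The first top letter absorbs its later copies, what follows it reduces to a shorter [desc] by
    induction, and the prefix is swallowed by [kword_cat_desc]. *)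
Lemma kword_run_eq0 k w : k <= m -> all (within k) w -> run k w = 0 ->
  kword w = kword (desc k).
Proof.
elim: k w => [|k IHk] w km.
  by case: w => // i w /= /andP[/andP[i0]]; rewrite leqNgt i0.
case: (runP w km) => [-> //|p q wE runE].
rewrite -[X in run _ X]cats0 runE cats0.
rewrite wE all_cat /= => /and3P[pk _ qk] q0.
rewrite -(kword_cat_desc km pk) /=; apply: kword_cat_congr => //.
rewrite kword_erase inordK ?ltnS //.
  by apply: kword_cons_congr; apply: IHk; rewrite ?all_within_filter // ltnW.
by apply: sub_all qk => i /andP[].
Qed.

(* If u contains the top letter, then its first occurrence in u absorbs all   *)
(* later ones, on both sides, and the induction goes on with one letter less; *)
(* if it does not, then v alone reads the whole of desc k.                    *)
Lemma kword_run_cat_eq0 k u v : k <= m ->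
    all (within k) u -> all (within k) v -> run k (u ++ v) = 0 ->
  kword (u ++ ord0 :: v) = kword (u ++ ord0 :: desc k).
Proof.
elim: k u v => [|k IHk] u v km.
  by case: v => // i v _ /= /andP[/andP[i0]]; rewrite leqNgt i0.
case: (runP u km) => [_ ->|p q uE runE] uk vk.
  move=> v0; apply/kword_cat_congr => //.
  exact/kword_cons_congr/kword_run_eq0.
rewrite runE filter_cat; move: uk; rewrite uE all_cat /= => /and3P[_ _ qk].
move=> /(IHk _ _ (ltnW km) (all_within_filter qk) (all_within_filter vk)) IH.
rewrite -!catA /=; apply: kword_cat_congr => //.
have erase w : all (within k.+1) w ->
    kword (inord k.+1 :: q ++ ord0 :: w) =
    kword (inord k.+1 :: [seq i : 'I_m.+1 <- q | i < k.+1] ++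
                ord0 :: [seq i : 'I_m.+1 <- w | i < k.+1]).
  move=> wk; rewrite kword_erase inordK ?ltnS //; first by rewrite filter_cat.
  have le_within : subpred (within k.+1) (fun i => i <= k.+1).
    by move=> i /andP[].
  by rewrite all_cat /= (sub_all le_within qk) (sub_all le_within wk).
rewrite !erase ?all_desc // (kword_cons_congr _ IH) /=.
by rewrite inordK ?ltnS // ltnn filter_desc // ltnW.
Qed.

(** Mirror image of [kword_absorb]: the lowest letter is absorbed by a later copy of itself,
    whatever stands between. *)
Lemma kword_absorb_ord0 v : kword (ord0 :: rcons v ord0) = kword (rcons v ord0).
Proof.
elim: v => [|i v IHv]; first exact/kwordP/krel_idem.
rewrite rcons_cons; have [i0|i_gt0] := posnP i.
  have -> : i = ord0 by apply: val_inj.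
  apply: (@kword_cat_congr _ [:: _; _] [:: _]) => //.
  exact/kwordP/krel_idem.
rewrite -[RHS](kword_cons_congr _ IHv).
rewrite -(kword_cons_congr _ (kword_cons_congr _ IHv)).
apply: (@kword_cat_congr _ [:: _; _; _] [:: _; _]) => //.
exact/kwordP/krel_jij.
Qed.

Lemma run_ord0 t v w : run t (v ++ ord0 :: w) = run t (v ++ w).
Proof. by rewrite -run_gt0 filter_cat /= -filter_cat run_gt0. Qed.

Lemma kword_erase_ord0 v w :
  kword (v ++ ord0 :: w) = kword ([seq i : 'I_m.+1 <- v | 0 < i] ++ ord0 :: w).
Proof.
elim: v => //= i v IHv; case: posnP => [i0|_] /=; last exact: kword_cons_congr.
rewrite -IHv -cat_rcons; apply: (@kword_cat_congr _ (_ :: _)) => //.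
by have -> : i = ord0; [apply: val_inj|apply: kword_absorb_ord0].
Qed.

Lemma kdel_kseg1 w :
  kdel (kseg m.+1 1) (kword w) = kword [seq i : 'I_m.+1 <- w | 0 < i].
Proof.
rewrite kdel_word; congr kword; apply: eq_filter => i.
by rewrite inE -leqNgt.
Qed.

Lemma all_within_gt0 w : all (within m) [seq i : 'I_m.+1 <- w | 0 < i].
Proof.
apply/allP=> i; rewrite mem_filter => /andP[i0 _].
by rewrite /within i0 -ltnS ltn_ord.
Qed.

Lemma all_within_notin0 w : ord0 \notin w -> all (within m) w.
Proof.
move=> Nw; apply/allP=> i iw; rewrite /within -[i <= m]ltnS ltn_ord andbT lt0n.
by apply: contraNneq Nw => i0; have <- : i = ord0 by apply: val_inj.
Qed.

Lemma mem_kball_kzero w : (kword w \in kball (kzero m.+1) 1) = (run m w == 0).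
Proof.
have zE : kzero m.+1 = kword (rev (enum 'I_m.+1)) by rewrite kword_prod.
rewrite mem_kball // zE !kdel_kseg1; apply/eqP/eqP => [/kwordP/run_rel E|w0].
  by rewrite -run_gt0 -E run_gt0 run_rev_enum.
have desc_gt0 v : run m v = 0 ->
    kword [seq i : 'I_m.+1 <- v | 0 < i] = kword (desc m).
  by move=> v0; apply: kword_run_eq0; rewrite ?all_within_gt0 ?run_gt0.
by rewrite !desc_gt0 ?run_rev_enum.
Qed.

Lemma run_desc : run m (desc m) = 0.
Proof.
suff all_k k : k <= m -> run k (desc k) = 0 by apply: all_k.
elim: k => //= k IHk km; rewrite -[RHS](IHk (ltnW km)) /run /= {2}/step.
by rewrite inordK // eqxx.
Qed.

End Positive.

(** * Recovering the element of the smaller semigroup *)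

Section LastZero.
Variable m : nat.
Implicit Types (u v w : seq 'I_m.+1).

Definition lower w : seq 'I_m := pmap (unlift ord0) w.

(** The prefix before the last 0, passed through [lower]; empty by default when there is no 0. *)
Fixpoint before_last0 w : seq 'I_m :=
  if w is i :: w' then
    if ord0 \in w' then lower [:: i] ++ before_last0 w' else [::]
  else [::].

Lemma lower_cat u v : lower (u ++ v) = lower u ++ lower v.
Proof. exact: pmap_cat. Qed.

Lemma before_last0_cat u v :
  before_last0 (u ++ v) =
  if ord0 \in v then lower u ++ before_last0 v else before_last0 u.
Proof.
elim: u => [|i u IHu] /=.
  case: ifPn => //; elim: v => //= i v IHv.
  by rewrite inE negb_or => /andP[_ /negPf->].
rewrite mem_cat orbC IHu; case: (ord0 \in v) => //=.
by rewrite /lower /=; case: unlift.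
Qed.

(** The first two invariants are needed for the third, by [before_last0_cat]. In the relations with
    [j = 0 < i], all three words have the lowered [i] alone as prefix. *)
Lemma kiselman_rel_before_last0 u v : kiselman_rel u v ->
  [/\ (ord0 \in u) = (ord0 \in v), kiselman_rel (lower u) (lower v) &
      kiselman_rel (before_last0 u) (before_last0 v)].
Proof.
elim=> {u v} [i|i j|i j|u|u v _ [? ? ?]|u v w _ [-> uv uv'] _ [-> vw vw']|
              u v w z _ [Euv uv uv'] _ [Ewz wz wz']].
- rewrite !inE orbb /lower /=.
  by case: (unliftP ord0 i) => [i'|] -> /=; split=> //; constructor.
- case: (unliftP ord0 i) => [i'|] -> //; case: (unliftP ord0 j) => [j'|] -> ji;
    by rewrite !inE /lower /= ?inE /= ?liftK ?unlift_none /=; split=> //; constructor.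
- case: (unliftP ord0 i) => [i'|] -> //; case: (unliftP ord0 j) => [j'|] -> ji;
    by rewrite !inE /lower /= ?inE /= ?liftK ?unlift_none /=; split=> //; constructor.
- by split=> //; constructor.
- by split=> //; apply: krel_sym.
- by split=> //; [apply: krel_trans vw|apply: krel_trans vw'].
- rewrite !mem_cat !lower_cat !before_last0_cat Euv Ewz; split=> //.
    exact: krel_cat.
  by case: ifP => // _; apply: krel_cat.
Qed.

Definition raise (w : seq 'I_m) : seq 'I_m.+1 := map (lift ord0) w.

Lemma kiselman_rel_raise (w w' : seq 'I_m) :
  kiselman_rel w w' -> kiselman_rel (raise w) (raise w').
Proof.
elim=> {w w'} [i|i j ji|i j ji|u|u v _|u v w _ uv _|u v w z _ uv _].
- exact: krel_idem.
- exact: krel_iji.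
- exact: krel_jij.
- exact: krel_refl.
- exact: krel_sym.
- exact: krel_trans.
- by rewrite /raise !map_cat; apply: krel_cat.
Qed.

Lemma ord0_notin_raise (w : seq 'I_m) : ord0 \notin raise w.
Proof. by apply/negP=> /mapP[i _ /eqP]; rewrite eqE. Qed.

Lemma lowerK w : raise (lower w) = [seq i : 'I_m.+1 <- w | 0 < i].
Proof.
elim: w => //= i w IHw; rewrite /lower /=.
by case: (unliftP ord0 i) => [i'|] -> /=; rewrite -IHw.
Qed.

Lemma raiseK (w : seq 'I_m) : lower (raise w) = w.
Proof. by elim: w => //= i w IHw; rewrite /lower /= liftK /= -/(lower _) IHw. Qed.

Lemma ord0_notin_desc k : k <= m -> ord0 \notin desc m k.
Proof. by move=> km; apply/negP=> /(allP (all_desc km)). Qed.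

Definition ball_elt (x : kiselman m) : kiselman m.+1 :=
  kword (raise (repr x) ++ ord0 :: desc m m).

Lemma ball_elt_inj : injective ball_elt.
Proof.
have pre0 (w : seq 'I_m) : before_last0 (raise w ++ ord0 :: desc m m) = w.
  rewrite before_last0_cat mem_head raiseK /=.
  by rewrite (negPf (ord0_notin_desc _)) // cats0.
move=> x y /kwordP/kiselman_rel_before_last0[_ _].
by rewrite !pre0 => /kwordP; rewrite !kword_repr.
Qed.

Lemma kball_kzero :
  kball (kzero m.+1) 1 = kword (desc m m) |: [set ball_elt x | x : kiselman m].
Proof.
apply/setP; elim/kword_ind=> w; rewrite mem_kball_kzero !inE.
apply/eqP/orP=> [w0|[/eqP/kwordP/run_rel->|/imsetP[x _ /kwordP/run_rel->]]].
- have [/mem_split_last[p [q [wE q0]]]|Nw] := boolP (ord0 \in w).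
    right; apply/imsetP; exists (kword (lower p)) => //.
    (* The value of [ball_elt] does not depend on the representative chosen by [repr]. *)
    have <- : kword (raise (lower p) ++ ord0 :: desc m m) = ball_elt (kword (lower p)).
      apply/kword_cat_congr => //; apply/kwordP/kiselman_rel_raise/kwordP.
      by rewrite kword_repr.
    rewrite wE [LHS]kword_erase_ord0 lowerK; apply: kword_run_cat_eq0 => //.
    + exact: all_within_gt0.
    + exact: all_within_notin0.
    + by rewrite run_cat run_gt0 -run_cat -run_ord0 -wE.
  by left; apply/eqP/kword_run_eq0; rewrite ?all_within_notin0.
- exact: run_desc.
- rewrite run_ord0.
  have raise_x := all_within_notin0 (ord0_notin_raise (repr x)).
  have /kwordP/run_rel-> := kword_cat_desc (leqnn m) raise_x.
  exact: run_desc.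
Qed.

Lemma card_kball_kzero : #|kball (kzero m.+1) 1| = (#|{: kiselman m}|).+1.
Proof.
rewrite kball_kzero cardsU1 card_imset; last exact: ball_elt_inj.
(* The extra element [desc m m] avoids a_1, while every [ball_elt x] contains it. *)
case: imsetP => [[x _ /kwordP/kiselman_rel_before_last0[]]|//].
by rewrite mem_cat mem_head orbT (negPf (ord0_notin_desc _)).
Qed.

End LastZero.

Theorem corollary7p3 (n : nat) (n_gt1 : 1 < n) :
  #|kball (kzero n) 1| = 1 + #|{: kiselman n.-1}| /\
  #|ksphere (kzero n) 1| = #|{: kiselman n.-1}|.
Proof.
case: n n_gt1 => // m _; have E := card_kball_kzero m.
by split=> //; apply: succn_inj; rewrite -card_kball1 E.
Qed.
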